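(* Let $K\subset\mathbb R^d$, $d\ge1$, be any compact container, and consider an inventory of at most three rings with arbitrary strictly decreasing positive radii and common width $w>0$. Then every descending greedy execution places exactly the lex-max set.
   Context: Model. Fix a width $w>0$ and a compact container $K\subset\mathbb R^d$ (the pan). An inventory is a finite list of radii $r_1>r_2>\dots>r_n>0$; ring $i$ has outer radius $r_i$ and hole radius $\max(0,r_i-w)$. A placement of a set $S\subseteq\{1,\dots,n\}$ of rings is a forest: each ring of $S$ has as parent either the pan or another ring of $S$ with $r_{\mathrm{child}}\le r_{\mathrm{parent}}-w$, and the children of each common parent must be packable in the parent's region ($K$ for the pan; a ball of radius $r-w$ for the hole of a ring of radius $r$), i.e. closed balls having the children's outer radii can be positioned inside that region with pairwise disjoint interiors. Feasibility depends only on the parent assignment (siblings may be rearranged freely). $S$ is feasible if it has a placement. The lex-max set $L$ is defined by scanning $i=1,\dots,n$ and including $i$ whenever $(L\cap\{1,\dots,i-1\})\cup\{i\}$ is feasible. A descending greedy execution processes the rings in decreasing radius; when ring $i$ is processed, a container (the pan or the hole of an already placed ring) admits it if the container's current children together with ring $i$ are packable in it; the ring receives some admitting container as its permanent parent (chosen by an arbitrary rule), and is skipped only if no container admits it. *)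

(* Defs.v *)
From HB Require Import structures.
From mathcomp Require Import all_boot all_order all_algebra.
From mathcomp Require Import all_classical all_reals all_analysis.

Set Implicit Arguments.
Unset Strict Implicit.
Unset Printing Implicit Defensive.
Import Order.TTheory GRing.Theory Num.Theory.
Import numFieldNormedType.Exports.
Local Open Scope classical_set_scope.
Local Open Scope ring_scope.

(* R^d is ['rV[R]_d].  Its library norm is the sup norm, hence the Euclidean
   norm below; both induce the library topology. *)
Definition enorm (R : realType) (d : nat) (x : 'rV[R]_d) : R :=
  Num.sqrt (\sum_(k < d) x 0 k ^+ 2).

Definition eball (R : realType) (d : nat) (c : 'rV[R]_d) (rho : R) :
    set 'rV[R]_d :=
  closed_ball_ (@enorm R d) c rho.

(* Rings are indexed by ['I_n], in decreasing order of their outer radii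
   [r : 'I_n -> R]. *)

Definition packable (R : realType) (d n : nat) (r : 'I_n -> R)
    (A : set 'rV[R]_d) (C : {set 'I_n}) : Prop :=
  exists c : 'I_n -> 'rV[R]_d,
    (forall i, i \in C -> eball (c i) (r i) `<=` A) /\
    (forall i j, i \in C -> j \in C -> i != j ->
       interior (eball (c i) (r i)) `&` interior (eball (c j) (r j)) = set0).

(* [None] is the pan and [Some j] is the hole of ring [j]. *)
Notation container n := (option 'I_n).

(* Only the hole's shape matters, so it is centred at the origin. *)
Definition region (R : realType) (d n : nat) (K : set 'rV[R]_d) (w : R)
    (r : 'I_n -> R) (c : container n) : set 'rV[R]_d :=
  if c is Some j then eball 0 (Num.max 0 (r j - w)) else K.

(* [s i = None] if ring [i] is not placed, and [s i = Some c] if its parent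
   is the container [c]. *)
Notation assignment n := {ffun 'I_n -> option (container n)}.

Definition placed (n : nat) (s : assignment n) : {set 'I_n} :=
  [set i | s i != None]%SET.

Definition children (n : nat) (s : assignment n) (c : container n) :
    {set 'I_n} :=
  [set i | s i == Some c]%SET.

(* For [0 < w] the radius condition makes radii strictly decrease from parent
   to child, so the parent relation is automatically acyclic (a forest). *)
Definition is_placement (R : realType) (d n : nat) (K : set 'rV[R]_d) (w : R)
    (r : 'I_n -> R) (s : assignment n) : Prop :=
  (forall i j, s i = Some (Some j) -> j \in placed s /\ r i <= r j - w) /\
  (forall c, packable r (region K w r c) (children s c)).

Definition feasible (R : realType) (d n : nat) (K : set 'rV[R]_d) (w : R)
    (r : 'I_n -> R) (S : {set 'I_n}) : Prop :=
  exists s : assignment n, placed s = S /\ is_placement K w r s.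

(* [enum 'I_n] lists the indices in increasing order. *)
Definition lexmax (R : realType) (d n : nat) (K : set 'rV[R]_d) (w : R)
    (r : 'I_n -> R) : {set 'I_n} :=
  foldl (fun (L : {set 'I_n}) (i : 'I_n) =>
           if `[< feasible K w r (i |: L)%SET >] then (i |: L)%SET else L)
    finset.set0 (enum 'I_n).

Definition available (n : nat) (s : assignment n) (c : container n) : Prop :=
  if c is Some j then j \in placed s else True.

Definition admits (R : realType) (d n : nat) (K : set 'rV[R]_d) (w : R)
    (r : 'I_n -> R) (s : assignment n) (c : container n) (i : 'I_n) : Prop :=
  available s c /\ packable r (region K w r c) (i |: children s c)%SET.

Definition place (n : nat) (s : assignment n) (i : 'I_n) (c : container n) :
    assignment n :=
  [ffun k => if k == i then Some c else s k].

(* The step is nondeterministic: any admitting container may be chosen. *)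
Inductive greedy_step (R : realType) (d n : nat) (K : set 'rV[R]_d) (w : R)
    (r : 'I_n -> R) (s : assignment n) (i : 'I_n) : assignment n -> Prop :=
| greedy_place c :
    admits K w r s c i -> greedy_step K w r s i (place s i c)
| greedy_skip :
    (forall c, ~ admits K w r s c i) -> greedy_step K w r s i s.

Inductive greedy_run (R : realType) (d n : nat) (K : set 'rV[R]_d) (w : R)
    (r : 'I_n -> R) : assignment n -> seq 'I_n -> assignment n -> Prop :=
| greedy_nil s : greedy_run K w r s [::] s
| greedy_cons s s' s'' i l :
    greedy_step K w r s i s' -> greedy_run K w r s' l s'' ->
    greedy_run K w r s (i :: l) s''.

Definition greedy_execution (R : realType) (d n : nat) (K : set 'rV[R]_d)
    (w : R) (r : 'I_n -> R) (s : assignment n) : Prop :=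
  greedy_run K w r [ffun=> None] (enum 'I_n) s.

(* Main.v *)
Require Import Defs.
From mathcomp Require Import all_boot all_order all_algebra.
From mathcomp Require Import all_classical all_reals all_analysis.
From mathcomp Require Import lra.

Set Implicit Arguments.
Unset Strict Implicit.
Unset Printing Implicit Defensive.
Import Order.TTheory GRing.Theory Num.Theory.
Import numFieldNormedType.Exports.
Local Open Scope ring_scope.

(** Greedy follows the lex-max scan ring by ring, so it suffices that, whenever
    the placed rings together with the next ring [i] form a feasible set, some
    container of the current placement [s] admits [i].  Let [t] be a placement
    of that larger set.  A ring can only sit in a strictly larger one, so the
    largest ring sits in the pan in both [s] and [t]; with at most three rings
    at most one other ring precedes [i], so [s] and [t] disagree on at most one
    ring [x].

    If they agree on all placed rings, [i] fits where [t] puts it.  Otherwise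
    [i] fits in the parent that [t] gives to [x]: in [s] this container holds
    only rings that [t] puts there too, and it lacks [x], so the smaller ball
    of [i] can take the spot of the ball of [x].  This exchange is
    [exchange_admits]; it rests on [packable_inj], which shrinks and drops balls
    of a packing.

    The converse, that an admitted ring extends the placement, needs the radius
    condition on parents.  It holds because a ball inside a ball has the smaller
    radius ([eball_sub_le]), which is where [d >= 1] enters. *)

Lemma coord_le_enorm (R : realType) (d : nat) (x : 'rV[R]_d) (k : 'I_d) :
  `|x 0 k| <= enorm x.
Proof.
rewrite /enorm -sqrtr_sqr ler_sqrt; last by apply: sumr_ge0 => i _; exact: sqr_ge0.
by rewrite (bigD1 k) //= lerDl sumr_ge0 // => i _; exact: sqr_ge0.
Qed.

Lemma enorm_scale_delta (R : realType) (d : nat) (a : R) (k : 'I_d) :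
  enorm (a *: delta_mx 0 k) = `|a|.
Proof.
rewrite /enorm (bigD1 k) //= big1 => [|i /negbTE ik].
  by rewrite !mxE !eqxx mulr1 addr0 sqrtr_sqr.
by rewrite !mxE ik andbF mulr0 expr0n.
Qed.

Lemma eballS (R : realType) (d : nat) (c : 'rV[R]_d) (a b : R) :
  a <= b -> (eball c a `<=` eball c b)%classic.
Proof. by move=> ab x /le_trans; apply. Qed.

(** The two ends of a diameter of the inner ball lie in the outer one, whose
    projection to that coordinate axis has length [2 * b]. *)
Lemma eball_sub_le (R : realType) (d : nat) (c c' : 'rV[R]_d) (a b : R) :
  (0 < d)%N -> 0 <= a -> (eball c a `<=` eball c' b)%classic -> a <= b.
Proof.
move=> d0 a0 sub; pose k := Ordinal d0.
have end_in (e : R) : `|e| = a -> `|c' 0 k - (c 0 k + e)| <= b.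
  move=> ea; have : eball c' b (c + e *: delta_mx 0 k).
    apply: sub; rewrite /eball /closed_ball_ /=.
    by rewrite opprD addNKr -scaleNr enorm_scale_delta normrN ea.
  rewrite /eball /closed_ball_ /=; apply: le_trans.
  by have := coord_le_enorm (c' - (c + e *: delta_mx 0 k)) k; rewrite !mxE !eqxx mulr1.
have := end_in a (ger0_norm a0).
have : `|- a| = a by rewrite normrN ger0_norm.
by move=> /end_in; rewrite !ler_norml => /andP[_ ?] /andP[? _]; lra.
Qed.

(** Each ball of the new packing is concentric with, and inside, the ball that
    it replaces. *)
Lemma packable_inj {R : realType} {d n : nat} (r : 'I_n -> R)
    (A : set 'rV[R]_d) {C D : {set 'I_n}} (f : 'I_n -> 'I_n) :
  {in D &, injective f} -> (forall i, i \in D -> f i \in C /\ r i <= r (f i)) ->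
  packable r A C -> packable r A D.
Proof.
move=> finj fP [c [cA cD]]; exists (c \o f); split=> [i iD|i j iD jD ij] /=.
  have [fC le] := fP i iD.
  exact: classical_sets.subset_trans (eballS le) (cA _ fC).
have [fiC lei] := fP i iD; have [fjC lej] := fP j jD.
have fij : f i != f j by apply: contraNneq ij => /finj ->.
apply: classical_sets.subsetI_eq0 (cD _ _ fiC fjC fij); exact/interiorS/eballS.
Qed.

Section Rings.
Context {R : realType} {d n : nat} {K : set 'rV[R]_d} {w : R} {r : 'I_n -> R}.
Hypotheses (d_gt0 : (0 < d)%N) (w_gt0 : 0 < w).
Hypothesis r_gt0 : forall i, 0 < r i.
Hypothesis r_decr : forall i j : 'I_n, (i < j)%N -> r j < r i.

Implicit Types (s t : {ffun 'I_n -> option (option 'I_n)}) (i j x : 'I_n).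

Lemma placed_childrenP s x : reflect (exists c, x \in children s c) (x \in placed s).
Proof.
rewrite inE; apply: (iffP idP) => [|[c]]; last by rewrite inE => /eqP ->.
by case E: (s x) => [c|] // _; exists c; rewrite inE E.
Qed.

Lemma packable_hole_le i j (C : {set 'I_n}) :
  i \in C -> packable r (region K w r (Some j)) C -> r i <= r j - w.
Proof.
move=> iC [c [/(_ i iC) /(eball_sub_le d_gt0 (ltW (r_gt0 i))) + _]].
by rewrite le_max leNgt r_gt0.
Qed.

Lemma parent_lt s x j : is_placement K w r s -> s x = Some (Some j) -> (j < x)%N.
Proof.
move=> [+ _] => /[apply] -[_ le]; rewrite ltnNge leq_eqVlt.
have : r x < r j by rewrite (le_lt_trans le) // ltrBlDr ltrDl.
by move=> lt; apply/negP => /orP[/eqP/val_inj xj|/r_decr/lt_gtF];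
  [rewrite xj ltxx in lt | rewrite lt].
Qed.

Lemma placed_place s i c : placed (place s i c) = i |: placed s.
Proof. by apply/setP => k; rewrite !inE ffunE; case: (k == i). Qed.

Lemma place_is_placement s i c :
  is_placement K w r s -> i \notin placed s -> admits K w r s c i ->
  is_placement K w r (place s i c).
Proof.
move=> [sr sp] iNs [av pk]; split=> [k j|c'].
  rewrite placed_place ffunE; case: eqP => [-> [cj]|_ /sr[js ?]].
    subst c; split; first by rewrite finset.in_setU av orbT.
    by apply: packable_hole_le pk; rewrite setU11.
  by rewrite finset.in_setU js orbT.
have [->|c'c] := eqVneq c' c.
  suff -> : children (place s i c) c = i |: children s c by [].
  by apply/setP => k; rewrite !inE ffunE; case: (k == i) => //=; rewrite eqxx.
suff -> : children (place s i c) c' = children s c' by [].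
apply/setP => k; rewrite !inE ffunE; have [->|//] := eqVneq k i.
move: iNs; rewrite inE negbK => /eqP ->.
by apply/negbTE; apply: contra c'c => /eqP[->].
Qed.

(** The container that admits [i] is the one given by [t] to the ring on which
    [s] and [t] disagree, or to [i] itself when they agree.  If it is the hole
    of a ring, that ring is larger than [i], hence already placed in [s]. *)
Lemma exchange_admits s t i :
  is_placement K w r t -> placed t = i |: placed s -> i \notin placed s ->
  {in placed s, forall x, r i <= r x} ->
  {in placed s &, forall x y, s x != t x -> s y != t y -> x = y} ->
  exists c, admits K w r s c i.
Proof.
move=> [tr tp] pt iNs rle uniq_dis.
(* Taking [x := i] covers the case in which [i] keeps its parent in [t]. *)
have take_spot x : x \in placed t -> r i <= r x ->
    {in placed s, forall y, s y = t x -> y != x /\ t y = t x} ->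
    exists c, admits K w r s c i.
  move=> /placed_childrenP[c]; rewrite inE => /eqP tx le agree; exists c; split.
    case: c tx => [j|] //= tx; have [jt xj] := tr _ _ tx.
    have lt : r i < r j.
      by rewrite (le_lt_trans le) // (le_lt_trans xj) // ltrBlDr ltrDl.
    by move: jt; rewrite pt finset.in_setU1 => /predU1P[ji|//]; rewrite ji ltxx in lt.
  pose f y := if y == i then x else y.
  have child y : y \in children s c -> [/\ y != i, y != x & t y = Some c].
    move=> yc; have ys : y \in placed s by apply/placed_childrenP; exists c.
    move: yc; rewrite inE -tx => /eqP /(agree _ ys)[yx ty]; split=> //.
    by apply: contraNneq iNs => <-.
  apply: (packable_inj (f := f)) (tp c) => [y z|y]; rewrite !finset.in_setU1.
    rewrite /f => /orP[/eqP ->|/child[/negbTE yi yx _]].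
      rewrite eqxx => /orP[/eqP ->|/child[/negbTE zi zx _]]; first by [].
      by rewrite zi => xz; rewrite xz eqxx in zx.
    rewrite yi => /orP[/eqP ->|/child[/negbTE -> _ _]] //.
    by rewrite eqxx => yx'; rewrite yx' eqxx in yx.
  rewrite /f => /orP[/eqP ->|/child[/negbTE -> _ ty]]; rewrite inE ?eqxx ?tx ?ty //.
have [/existsP[x /andP[xs dis]]|/existsPn agree] :=
    boolP [exists x, (x \in placed s) && (s x != t x)].
  apply: (take_spot x); [by rewrite pt finset.in_setU1 xs orbT | exact: rle |].
  move=> y ys syx; split; first by apply: contraNneq dis => yx; rewrite -{1}yx syx.
  have [<- //|/(uniq_dis _ _ ys xs)/(_ dis) -> //] := eqVneq (s y) (t y).
apply: (take_spot i); rewrite ?pt ?setU11 // => y ys <-; split.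
  by apply: contraNneq iNs => <-.
by have := agree y; rewrite ys negbK => /eqP.
Qed.

Lemma greedy_step_lexmax s i s' :
  (i <= 2)%N -> {in placed s, forall x, (x < i)%N} ->
  is_placement K w r s -> greedy_step K w r s i s' ->
  is_placement K w r s' /\
  placed s' = if `[< feasible K w r (i |: placed s) >] then i |: placed s
              else placed s.
Proof.
move=> i2 lti sP; have iNs : i \notin placed s.
  by apply/negP => /lti; rewrite ltnn.
case=> [c cP|skip].
  have s'P : is_placement K w r (place s i c) by exact: place_is_placement.
  split; rewrite // placed_place asboolT //; exists (place s i c).
  by rewrite placed_place.
split=> //; rewrite asboolF // => -[t [pt tP]].
suff [c /skip //] : exists c, admits K w r s c i.
apply: (exchange_admits (t := t)) => // [x /lti/r_decr/ltW //|].
(* Ring 0 sits in the pan in both placements, so only ring 1 can differ. *)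
have dis1 x : x \in placed s -> s x != t x -> x = 1%N :> nat.
  move=> xs; have /lti xi := xs.
  have [x0|x_gt0] := posnP x; last first.
    by move=> _; apply/eqP; rewrite eqn_leq x_gt0 andbT -ltnS (leq_trans xi).
  have pan u : is_placement K w r u -> x \in placed u -> u x = Some None.
    move=> uP; rewrite inE; case E: (u x) => [[j|]|] // _.
    by have := parent_lt uP E; rewrite x0.
  by rewrite !pan // pt finset.in_setU1 xs orbT.
by move=> x y xs ys /(dis1 _ xs) x1 /(dis1 _ ys) y1; apply: val_inj; rewrite /= x1 y1.
Qed.

Lemma greedy_run_lexmax s l s' :
  (n <= 3)%N -> sorted ltn (map val l) ->
  {in placed s & l, forall x i, (x < i)%N} -> is_placement K w r s ->
  greedy_run K w r s l s' ->
  placed s' = foldl (fun (L : {set 'I_n}) i =>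
      if `[< feasible K w r (i |: L) >] then i |: L else L) (placed s) l.
Proof.
move=> n3 + + + run; elim: run => {s l s'} [//|s s' s'' i l step run IH].
rewrite /= (path_sortedE ltn_trans) all_map => /andP[/allP il lsort] lti sP.
have i2 : (i <= 2)%N by rewrite -ltnS (leq_trans (ltn_ord i)).
have [|s'P <-] := greedy_step_lexmax i2 _ sP step.
  by move=> x xs; rewrite lti // mem_head.
apply: IH => // x j; case: step => [c _|_]; rewrite ?placed_place ?finset.in_setU1.
  by case/predU1P => [-> /il //|xs jl]; rewrite lti // in_cons jl orbT.
by move=> xs jl; rewrite lti // in_cons jl orbT.
Qed.

Lemma empty_is_placement : is_placement K w r [ffun=> None].
Proof.
split=> [i j|c]; first by rewrite ffunE.
by exists (fun=> 0); split=> [i|i j]; rewrite inE ffunE.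
Qed.

End Rings.

Theorem proposition11 (R : realType) (d : nat) (hd : (1 <= d)%N)
  (K : set 'rV[R]_d) (hK : compact K)
  (w : R) (hw : 0 < w)
  (n : nat) (hn : (n <= 3)%N) (r : 'I_n -> R)
  (hpos : forall i : 'I_n, 0 < r i)
  (hdec : forall i j : 'I_n, (i < j)%N -> r j < r i)
  (s : {ffun 'I_n -> option (option 'I_n)})
  (hs : greedy_execution K w r s) :
  placed s = lexmax K w r.
Proof.
have placed0 : placed [ffun=> None] = finset.set0 :> {set 'I_n}.
  by apply/setP => i; rewrite !inE ffunE.
rewrite /lexmax -placed0; apply: greedy_run_lexmax hs => //.
- by rewrite val_enum_ord iota_ltn_sorted.
- by rewrite placed0 => x i; rewrite inE.
- exact: empty_is_placement.
Qed.
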